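(* Let $K$ be an algebraically closed field of characteristic $0$, let $q\in K$ ($q\neq 0,1$) be a primitive $\ell$-th root of unity, and let $G=\mathbb{Z}_\ell\times\mathbb{Z}_\ell$. Then $T_G(K_q[x,y])=T_G(M_\ell(K))$. Moreover, the ideal of $G$-graded identities of $K_q[x,y]$ is generated, as a graded T-ideal, by the graded identities $$x_\mu x_\nu=\beta(\mu,\nu)\,x_\nu x_\mu,\qquad \mu,\nu\in G,$$ where $x_\mu$ and $x_\nu$ are (distinct) variables of degrees $\mu=(r,s)$ and $\nu=(t,w)$ respectively, and $\beta(\mu,\nu)=q^{ts-rw}$.
   Context: The quantum plane $K_q[x,y]$ is $K\langle x,y\rangle$ modulo the relation $yx-qxy=0$. It is $\mathbb{Z}_\ell\times\mathbb{Z}_\ell$-graded by giving the monomial $x^ry^s$ the degree $(r\bmod\ell,\ s\bmod\ell)$. $M_\ell(K)$ carries the Pauli $\mathbb{Z}_\ell\times\mathbb{Z}_\ell$-grading: with $A=\mathrm{diag}(q^{\ell-1},q^{\ell-2},\dots,q,1)$ and $B=e_{12}+e_{23}+\cdots+e_{\ell-1,\ell}+e_{\ell,1}$ (so $AB=qBA$, $A^\ell=B^\ell=\mathrm{Id}$), the component of degree $(r,s)$ is $K B^rA^s$ (so that $x\mapsto B$, $y\mapsto A$ is a graded homomorphism $K_q[x,y]\to M_\ell(K)$). For a group $G$, $K\langle X\mid G\rangle$ is the free unital associative $K$-algebra on a disjoint union $X=\bigcup_{g\in G}X_g$ of countably infinite sets, the variables in $X_g$ having degree $g$. For a $G$-graded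 algebra $C$, $T_G(C)$ is the ideal of all $f\in K\langle X\mid G\rangle$ vanishing under every substitution of each variable by a homogeneous element of $C$ of the same degree. An identity $f=g$ means $f-g$ is a graded identity. A graded T-ideal is an ideal closed under all graded endomorphisms of $K\langle X\mid G\rangle$; the one generated by a set is the smallest one containing it. *)

(* Defs.v *)
From HB Require Import structures.
From mathcomp Require Import all_boot all_order all_algebra.
From mathcomp Require Import generic_quotient ring_quotient.
From mathcomp Require Import boolp classical_sets.
From mathcomp.multinomials Require Import monalg.

Set Implicit Arguments.
Unset Strict Implicit.
Unset Printing Implicit Defensive.

Import GRing.Theory.
Local Open Scope classical_set_scope.
Local Open Scope ring_scope.

Definition submod_set (K : pzRingType) (V : lmodType K) (U : set V) : Prop :=
  U 0 /\ forall (a : K) (u v : V), U u -> U v -> U (a *: u + v).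

Definition lspan (K : pzRingType) (V : lmodType K) (S : set V) : set V :=
  smallest (@submod_set K V) S.

Definition ideal_set (A : pzRingType) (I : set A) : Prop :=
  [/\ I 0, forall u v, I u -> I v -> I (u + v)
     & forall a u b, I u -> I (a * u * b)].

(* [ring_quotient] only equips quotients of commutative rings with a ring     *)
(* structure; the next section covers algebras modulo two-sided ideals.       *)
HB.mixin Record isRightIdeal (R : nzRingType) (S : R -> bool) := {
  ideal_mulr : forall a, {in S, forall u, u * a \in S}
}.

#[short(type="ideal2")]
HB.structure Definition Ideal2 (R : nzRingType) :=
  {S of Idealr R S & isRightIdeal R S}.

Section AlgebraQuotient.
Variables (K : nzRingType) (A : algType K) (I : ideal2 A).
Local Open Scope quotient_scope.

Definition alg_quot : Type := {ideal_quot I}.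
HB.instance Definition _ := GRing.Zmodule.on alg_quot.
HB.instance Definition _ : EqQuotient A (Quotient.equiv I) alg_quot :=
  EqQuotient.on alg_quot.

Local Notation Q := alg_quot.
Implicit Types (x y z : Q).

Definition to_quot (u : A) : Q := \pi_Q u.

Lemma to_quot_eqP (u v : A) : reflect (to_quot u = to_quot v) (u - v \in I).
Proof.
by apply: (iffP idP) => [|/eqP]; rewrite Quotient.idealrBE => // /eqP.
Qed.

Lemma to_quotD (u v : A) : to_quot (u + v) = to_quot u + to_quot v.
Proof. exact: (@Quotient.pi_add A I). Qed.

Lemma to_quotK x : to_quot (repr x) = x.
Proof. exact: reprK. Qed.

Lemma repr_to_quot (u : A) : repr (to_quot u) - u \in I.
Proof. by apply/to_quot_eqP; rewrite to_quotK. Qed.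

Lemma to_quot_surj x : exists u, x = to_quot u.
Proof. by exists (repr x); rewrite to_quotK. Qed.

Definition quot_mul x y : Q := to_quot (repr x * repr y).
Definition quot_scale (a : K) x : Q := to_quot (a *: repr x).

Lemma to_quotM (u v : A) : to_quot (u * v) = quot_mul (to_quot u) (to_quot v).
Proof.
apply/esym/to_quot_eqP.
have -> : repr (to_quot u) * repr (to_quot v) - u * v =
    repr (to_quot u) * (repr (to_quot v) - v) + (repr (to_quot u) - u) * v.
  by rewrite mulrBr mulrBl addrA subrK.
by apply: rpredD; [apply: idealMr|apply: ideal_mulr]; exact: repr_to_quot.
Qed.

Lemma to_quotZ a (u : A) : to_quot (a *: u) = quot_scale a (to_quot u).
Proof.
apply/esym/to_quot_eqP; rewrite -scalerBr -mulr_algl.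
by apply: idealMr; exact: repr_to_quot.
Qed.

Lemma quot_mulA : associative quot_mul.
Proof.
move=> x y z; have [a ->] := to_quot_surj x; have [b ->] := to_quot_surj y.
have [c ->] := to_quot_surj z.
by rewrite -(to_quotM a b) -(to_quotM b c) -(to_quotM a) -(to_quotM _ c) mulrA.
Qed.

Lemma quot_mul1 : left_id (to_quot 1) quot_mul.
Proof.
by move=> x; have [a ->] := to_quot_surj x; rewrite -(to_quotM 1 a) mul1r.
Qed.

Lemma quot_mulr1 : right_id (to_quot 1) quot_mul.
Proof.
by move=> x; have [a ->] := to_quot_surj x; rewrite -(to_quotM a 1) mulr1.
Qed.

Lemma quot_mulDl : left_distributive quot_mul +%R.
Proof.
move=> x y z; have [a ->] := to_quot_surj x; have [b ->] := to_quot_surj y.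
have [c ->] := to_quot_surj z.
by rewrite -(to_quotD a b) -(to_quotM (a + b) c) -(to_quotM a c)
  -(to_quotM b c) mulrDl to_quotD.
Qed.

Lemma quot_mulDr : right_distributive quot_mul +%R.
Proof.
move=> x y z; have [a ->] := to_quot_surj x; have [b ->] := to_quot_surj y.
have [c ->] := to_quot_surj z.
by rewrite -(to_quotD b c) -(to_quotM a (b + c)) -(to_quotM a b)
  -(to_quotM a c) mulrDr to_quotD.
Qed.

Lemma to_quot0 : to_quot 0 = 0.
Proof. by apply: (addrI (to_quot 0)); rewrite -to_quotD !addr0. Qed.

Lemma to_quot_eq0 (u : A) : (to_quot u == 0) = (u \in I).
Proof.
rewrite -to_quot0; apply/eqP/idP => [/to_quot_eqP|uI]; rewrite ?subr0 //.
by apply/to_quot_eqP; rewrite subr0.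
Qed.

Lemma quot_nz : to_quot 1 != 0.
Proof. by rewrite to_quot_eq0 idealr1. Qed.

HB.instance Definition _ := GRing.Zmodule_isNzRing.Build Q
  quot_mulA quot_mul1 quot_mulr1 quot_mulDl quot_mulDr quot_nz.

Lemma quot_scaleA a b x : quot_scale a (quot_scale b x) = quot_scale (a * b) x.
Proof.
have [u ->] := to_quot_surj x.
by rewrite -(to_quotZ b u) -(to_quotZ a) -(to_quotZ _ u) scalerA.
Qed.

Lemma quot_scale1 : left_id 1 quot_scale.
Proof.
by move=> x; have [u ->] := to_quot_surj x; rewrite -to_quotZ scale1r.
Qed.

Lemma quot_scaleDr : right_distributive quot_scale +%R.
Proof.
move=> a x y; have [u ->] := to_quot_surj x; have [v ->] := to_quot_surj y.
by rewrite -to_quotD -(to_quotZ a u) -(to_quotZ a v) -(to_quotZ a (u + v))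
  scalerDr to_quotD.
Qed.

Lemma quot_scaleDl x : {morph quot_scale^~ x : a b / a + b}.
Proof.
move=> a b; have [u ->] := to_quot_surj x.
by rewrite -(to_quotZ a u) -(to_quotZ b u) -(to_quotZ (a + b) u)
  scalerDl to_quotD.
Qed.

HB.instance Definition _ := GRing.Zmodule_isLmodule.Build K Q
  quot_scaleA quot_scale1 quot_scaleDr quot_scaleDl.

Lemma quot_scaleAl (a : K) x y : a *: (x * y) = (a *: x) * y.
Proof.
have [u ->] := to_quot_surj x; have [v ->] := to_quot_surj y.
rewrite /GRing.scale /GRing.mul /= -(to_quotM u v) -(to_quotZ a u).
by rewrite -(to_quotZ a (u * v)) -(to_quotM _ v) scalerAl.
Qed.

HB.instance Definition _ := GRing.Lmodule_isLalgebra.Build K Q quot_scaleAl.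

Lemma quot_scaleAr (a : K) x y : a *: (x * y) = x * (a *: y).
Proof.
have [u ->] := to_quot_surj x; have [v ->] := to_quot_surj y.
rewrite /GRing.scale /GRing.mul /= -(to_quotM u v) -(to_quotZ a v).
by rewrite -(to_quotZ a (u * v)) -(to_quotM u) scalerAr.
Qed.

HB.instance Definition _ := GRing.Lalgebra_isAlgebra.Build K Q quot_scaleAr.

Lemma to_quot_zmod : zmod_morphism to_quot.
Proof.
move=> u v; apply: (addIr (to_quot v)); rewrite addrNK.
by rewrite -to_quotD addrNK.
Qed.
HB.instance Definition _ := GRing.isZmodMorphism.Build A Q to_quot to_quot_zmod.

Lemma to_quot_monoid : monoid_morphism to_quot.
Proof. by split=> // u v; exact: to_quotM. Qed.
HB.instance Definition _ :=
  GRing.isMonoidMorphism.Build A Q to_quot to_quot_monoid.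

Lemma to_quot_scalable : scalable to_quot.
Proof. by move=> a u; exact: to_quotZ. Qed.
HB.instance Definition _ :=
  GRing.isScalable.Build K A Q *:%R to_quot to_quot_scalable.

End AlgebraQuotient.

(* The alias is needed: multinomials already attaches to {malg K[M]} the      *)
(* algebra structure it has when the monoid M is commutative.                 *)
Definition freealg (K : comNzRingType) (X : choiceType) : Type :=
  {malg K[{fmonom X}]}.

Section FreeAlgebra.
Variables (K : comNzRingType) (X : choiceType).

HB.instance Definition _ := GRing.Lalgebra.on (freealg K X).

Lemma freealg_scaleAr (a : K) (u v : freealg K X) : a *: (u * v) = u * (a *: v).
Proof.
have mulrC c (w : freealg K X) : w * (c%:MP) = c *: w.
  apply: (etrans (fgmulgU _ _ _)).
  rewrite [RHS]malgZ_def; apply: eq_bigr => k _.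
  by rewrite mulm1 mulrC.
by rewrite -mulrC -mulrA mulrC.
Qed.

HB.instance Definition _ :=
  GRing.Lalgebra_isAlgebra.Build K (freealg K X) freealg_scaleAr.

Definition fmon (m : {fmonom X}) : freealg K X := mkmalgU m 1.
Definition fvar (v : X) : freealg K X := fmon (fmu v).

Definition feval (C : algType K) (s : X -> C) (f : freealg K X) : C :=
  mmap (in_alg C) (fun m : {fmonom X} => \prod_(v <- (m : seq X)) s v) f.

End FreeAlgebra.

Section GradedIdentities.
Variables (K : comNzRingType) (G : zmodType).

(* The variables are the pairs (g, i), so that X_g = {g} x nat.               *)
Definition gvar : choiceType := (G * nat)%type.
Local Notation F := (freealg K gvar).

Definition mon_degree (m : {fmonom gvar}) : G := \sum_(v <- (m : seq gvar)) v.1.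

Definition free_grading (g : G) : set F :=
  lspan [set fmon K m | m in [set m | mon_degree m = g]].

Definition graded_identities (C : algType K) (gr : G -> set C) : set F :=
  [set f | forall s : gvar -> C, (forall v, gr v.1 (s v)) -> feval s f = 0].

Definition graded_endo (phi : {lrmorphism F -> F}) : Prop :=
  forall g f, free_grading g f -> free_grading g (phi f).

Definition graded_T_ideal (I : set F) : Prop :=
  ideal_set I /\
  forall phi : {lrmorphism F -> F}, graded_endo phi ->
    forall f, I f -> I (phi f).

Definition T_ideal_generated (S : set F) : set F := smallest graded_T_ideal S.

End GradedIdentities.

Section QuantumPlane.
Variables (K : fieldType) (q : K).

Local Notation F2 := (freealg K 'I_2).
Definition freex : F2 := fvar K (inord 0).
Definition freey : F2 := fvar K (inord 1).

Definition qplane_ideal_set : set F2 :=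
  smallest (@ideal_set F2) [set freey * freex - q *: (freex * freey)].

Definition qplane_ideal (f : F2) : bool := `[< qplane_ideal_set f >].

Lemma qplane_ideal_set_ideal : ideal_set qplane_ideal_set.
Proof.
split=> [J [[]] //|u v uI vI J JP|a u b uI J JP].
  by case: (JP) => -[_ JD _] _; apply: JD; [exact: uI|exact: vI].
by case: (JP) => -[_ _ JM] _; apply: JM; exact: uI.
Qed.

Definition const_term (f : F2) : K := mcoeff (mone : {fmonom 'I_2}) f.

Lemma const_termM (f g : F2) : const_term (f * g) = const_term f * const_term g.
Proof. exact: (mcoeff1g_is_multiplicative _ _).1. Qed.

Lemma const_termD (f g : F2) : const_term (f + g) = const_term f + const_term g.
Proof. exact: (mcoeffD mone). Qed.

Lemma const_termZ a (f : F2) : const_term (a *: f) = a * const_term f.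
Proof. exact: mcoeffZ. Qed.

Lemma const_term1 : const_term 1 = 1.
Proof. by apply: (etrans (mcoeff1 _ _)); rewrite eqxx. Qed.

Lemma const_termN (f : F2) : const_term (- f) = - const_term f.
Proof. by rewrite -scaleN1r const_termZ mulN1r. Qed.

Lemma qplane_ideal_const_term (f : F2) : qplane_ideal_set f -> const_term f = 0.
Proof.
move=> If; apply: (If [set g | const_term g = 0]); split=> [|_ ->] /=.
  split=> [|u v /= u0 v0|a u b /= u0]; first exact: mcoeff0.
    by rewrite const_termD u0 v0 addr0.
  by rewrite 2!const_termM u0 mulr0 mul0r.
have x0 : const_term freex = 0.
  apply: (etrans (mcoeffU1 _ _ _)); case: eqP => // /(congr1 (@fdeg _)).
  by rewrite fdegU fdeg1.
have constM0 (g h : F2) :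
    const_term g * const_term h = 0 -> const_term (g * h) = 0.
  by rewrite const_termM.
rewrite const_termD const_termN const_termZ.
rewrite [X in X - _]constM0 ?x0 ?mulr0 //.
by rewrite [X in _ * X]constM0 ?x0 ?mul0r ?mulr0 ?subr0.
Qed.

Lemma qplane_ideal_idealr : idealr_closed qplane_ideal.
Proof.
have [I0 ID IM] := qplane_ideal_set_ideal.
split; first exact/asboolP.
  apply/negP => /asboolP /qplane_ideal_const_term /eqP.
  by rewrite const_term1 oner_eq0.
move=> a u v /asboolP Iu /asboolP Iv; apply/asboolP; apply: (ID) => //.
by rewrite -[_ * _]mulr1; apply: IM.
Qed.
HB.instance Definition _ := isIdealr.Build F2 qplane_ideal qplane_ideal_idealr.

Lemma qplane_ideal_right a :
  {in qplane_ideal, forall u, u * a \in qplane_ideal}.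
Proof.
have [_ _ IM] := qplane_ideal_set_ideal.
move=> u /asboolP Iu; apply/asboolP.
by rewrite -[u]mul1r; apply: IM.
Qed.
HB.instance Definition _ := isRightIdeal.Build
  F2 qplane_ideal qplane_ideal_right.

Definition qplane := alg_quot qplane_ideal.
HB.instance Definition _ := GRing.Algebra.on qplane.

Definition qx : qplane := to_quot qplane_ideal freex.
Definition qy : qplane := to_quot qplane_ideal freey.

Lemma qplane_rel : qy * qx = q *: (qx * qy).
Proof.
rewrite -!rmorphM -linearZ; apply/to_quot_eqP/asboolP.
by move=> J [_]; apply.
Qed.

End QuantumPlane.

Section Gradings.
Variables (K : fieldType) (n : nat) (q : K).
(* Square matrices only form an algType in dimension m.+1, and 'Z_l is Z/l    *)
(* only for l > 1: writing l as n.+2 accounts for both, and covers every l    *)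
(* for which some q != 1 is a primitive l-th root of unity.                   *)
Local Notation l := n.+2.
Local Notation G := ('Z_l * 'Z_l)%type.
Local Notation X := (gvar
  ltac:(let t := eval cbv beta delta [reverse_coercion] in (G : zmodType) in
        exact t)) (only parsing).

Definition qplane_grading (g : G) : set (qplane q) :=
  lspan [set u | exists a b : nat,
                   (a%:R, b%:R) = g /\ u = qx q ^+ a * qy q ^+ b].

Definition pauliA : 'M[K]_l := diag_mx (\row_(i < l) q ^+ (l.-1 - i)).

(* The sum i + 1 is taken in 'Z_l, so that the last row is that of e_{l,1}.   *)
Definition pauliB : 'M[K]_l := \matrix_(i, j) (j == i + 1 :> 'Z_l)%:R.

Definition pauli_grading (g : G) : set 'M[K]_l :=
  lspan [set pauliB ^+ g.1 * pauliA ^+ g.2].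

(* The residues are represented by naturals below l; the choice is immaterial *)
(* when q ^+ l = 1.                                                           *)
Definition beta (mu nu : G) : K :=
  q ^ ((nu.1 * mu.2)%N%:Z - (mu.1 * nu.2)%N%:Z).

Definition comm_identities : set (freealg K X) :=
  [set f | exists (mu nu : G) (i j : nat), (mu, i) <> (nu, j) /\
    let x_mu := fvar K ((mu, i) : X) in let x_nu := fvar K ((nu, j) : X) in
    f = x_mu * x_nu - beta mu nu *: (x_nu * x_mu)].

End Gradings.

(* Main.v *)
From HB Require Import structures.
Require Import Defs.
From mathcomp Require Import all_boot all_order all_algebra.
From mathcomp Require Import boolp classical_sets.
From mathcomp Require Import finmap.
From mathcomp.multinomials Require Import monalg.

Set Implicit Arguments.
Unset Strict Implicit.
Unset Printing Implicit Defensive.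

Import GRing.Theory.
Local Open Scope classical_set_scope.
Local Open Scope ring_scope.

(** Modulo the relations x_mu x_nu = beta(mu, nu) x_nu x_mu every word in the
    variables is a scalar multiple of its sorted rearrangement, so these
    relations leave room only for combinations of sorted words.  The theorem
    then follows from a cycle of three inclusions

      T(beta relations) <= Id(quantum plane) <= Id(M_l(K)) <= T(beta relations).

    The first one ([T_ideal_sub_qplane]) holds because y^b x^a = q^(b a) x^a y^b
    in the quantum plane, so homogeneous elements commute up to beta
    ([qplane_beta]), and because the identities of an algebra with a
    multiplicative grading form a graded T-ideal ([graded_identities_T_ideal]).

    The second one ([qplane_identities_sub_pauli]) holds because x |-> B,
    y |-> A maps each homogeneous component of the quantum plane onto the
    component of M_l(K) of the same degree: a graded substitution in M_l(K)
    lifts to one in the quantum plane.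

    For the third one ([pauli_identities_sub]) let f be a graded identity of
    M_l(K), and substitute t_v B^r A^s for each variable v of degree (r, s).  A
    word m becomes t^m P_m, where the matrix P_m is invertible and the scalar
    t^m is the product of the t_v along m; it depends only on the sorted form of
    m.  Taking for the t_v the k-th powers of distinct primes makes t^m the k-th
    power of an integer from which, by unique factorization, the sorted form of
    m can be read off.  As k varies, a Vandermonde argument
    ([power_sum_separation]) separates these integers, which are distinct in K
    because K has characteristic 0.  So the part of f supported on the words
    with a given sorted form vanishes at the P_m; as that part is congruent to a
    multiple of one sorted word, whose value is invertible, the multiple is
    0, and f lies in the T-ideal. *)

(** * Evaluation on the free algebra *)

Section AlgebraMorphisms.
Variables (K : comNzRingType) (C D : algType K) (phi : {lrmorphism C -> D}).

Lemma lrmorph_scaled_mon c (x y : C) a b :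
  phi (c *: (x ^+ a * y ^+ b)) = c *: (phi x ^+ a * phi y ^+ b).
Proof. by rewrite linearZ rmorphM !rmorphXn. Qed.

Lemma lrmorph_q_commutator q (x y : C) :
  phi (y * x - q *: (x * y)) = phi y * phi x - q *: (phi x * phi y).
Proof. by rewrite raddfB /= linearZ !rmorphM. Qed.

End AlgebraMorphisms.

Section FreeAlgebraTheory.
Variables (K : comNzRingType) (X : choiceType).
Implicit Types (f : freealg K X) (m : {fmonom X}).

Lemma fmon1 : fmon K (FMonom [::]) = 1 :> freealg K X.
Proof. by rewrite -fmoneE. Qed.

Lemma fmonM m1 m2 :
  fmon K (FMonom (m1 ++ m2)) = fmon K m1 * fmon K m2 :> freealg K X.
Proof.
by rewrite -fmmulE; apply/esym/(etrans (fgmulUU _ _ _ _)); rewrite mul1r.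
Qed.

Lemma fmon_cons v (s : seq X) :
  fmon K (FMonom (v :: s)) = fvar K v * fmon K (FMonom s) :> freealg K X.
Proof. by rewrite /fvar fmuE -fmonM. Qed.

Lemma fmon_prod (s : seq X) : fmon K (FMonom s) = \prod_(v <- s) fvar K v.
Proof.
elim: s => [|v s IHs]; first by rewrite big_nil fmon1.
by rewrite big_cons -IHs fmon_cons.
Qed.

Lemma freealgE f : f = \sum_(m <- msupp f) mcoeff m f *: fmon K m.
Proof.
rewrite {1}[LHS](monalgE f); apply: eq_bigr => m _.
apply/(malgP (_ : malg _ _)) => k.
rewrite mcoeffU; apply/esym/(etrans (mcoeffZ _ _ _)).
by rewrite mcoeffU mulrnAr mulr1.
Qed.

Lemma freealg_ind (P : freealg K X -> Prop) :
  P 0 -> (forall a m f, P f -> P (a *: fmon K m + f)) -> forall f, P f.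
Proof.
move=> P0 PD f; rewrite [f]freealgE; elim: {1}(enum_fset _) => [|m r IHr].
  by rewrite big_nil.
by rewrite big_cons; apply: PD.
Qed.

Lemma freealg_eq0 f : (forall m, mcoeff m f = 0) -> f = 0.
Proof.
by move=> f0; rewrite [f]freealgE big1 // => m _; rewrite f0 scale0r.
Qed.

Lemma mcoeff_sum_fmon (I : Type) (r : seq I) (a : I -> K) (h : I -> {fmonom X})
    k :
  mcoeff k (\sum_(i <- r) a i *: fmon K (h i) : freealg K X) =
  \sum_(i <- r | h i == k) a i.
Proof.
rewrite [RHS]big_mkcond /=.
elim: r => [|i r IHr]; first by rewrite !big_nil; apply: mcoeff0.
rewrite !big_cons -IHr; apply: (etrans (mcoeffD _ _ _)); congr (_ + _).
apply: (etrans (mcoeffZ _ _ _)).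
by rewrite mcoeffU1 mulr_natr mulrb.
Qed.

Section Evaluation.
Variables (C : algType K) (s : X -> C).

Lemma feval_zmod : zmod_morphism (feval s).
Proof. exact: mmap_is_additive. Qed.
HB.instance Definition _ :=
  GRing.isZmodMorphism.Build (freealg K X) C (feval s) feval_zmod.

Lemma feval_fmon m : feval s (fmon K m) = \prod_(v <- (m : seq X)) s v.
Proof. by rewrite /feval /fmon mmapU /= scale1r mul1r. Qed.

Lemma feval_scalable : scalable (feval s).
Proof.
move=> a f; rewrite /feval (mmapEw (msuppZ_le _ _)).
rewrite [mmap _ _ f]mmapE scaler_sumr.
by apply: eq_bigr => m _; rewrite mcoeffZ /= -scalerA scalerAl.
Qed.
HB.instance Definition _ :=
  GRing.isScalable.Build K (freealg K X) C *:%R (feval s) feval_scalable.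

Lemma feval_monoid : monoid_morphism (feval s).
Proof.
split=> [|f g]; first by rewrite -fmon1 feval_fmon big_nil.
elim/freealg_ind: f => [|a m f IHf]; first by rewrite mul0r raddf0 mul0r.
rewrite mulrDl -scalerAl 2!linearP mulrDl -scalerAl.
congr (_ *: _ + _); last exact: IHf.
elim/freealg_ind: g {f IHf} => [|b k g IHg].
  by rewrite mulr0 !raddf0 mulr0.
rewrite mulrDr -scalerAr 2!linearP mulrDr -scalerAr.
congr (_ *: _ + _); last exact: IHg.
by rewrite -fmonM /= !feval_fmon big_cat.
Qed.
HB.instance Definition _ :=
  GRing.isMonoidMorphism.Build (freealg K X) C (feval s) feval_monoid.

Lemma feval_fvar v : feval s (fvar K v) = s v.
Proof. by rewrite feval_fmon fmuE big_seq1. Qed.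

End Evaluation.

(** The universal property of the free algebra, in its uniqueness form. *)
Lemma lrmorph_feval (C : algType K) (phi : {lrmorphism freealg K X -> C}) f :
  phi f = feval (fun v => phi (fvar K v)) f.
Proof.
elim/freealg_ind: f => [|a m f IHf]; first by rewrite !raddf0.
rewrite !linearP /= {}IHf feval_fmon; congr (_ *: _ + _).
by case: m => s; rewrite fmon_prod rmorph_prod.
Qed.

(** Both sides are algebra morphisms agreeing on the variables.  This is what
    transports identities along morphisms of algebras. *)
Lemma feval_comp (C D : algType K) (phi : {lrmorphism C -> D}) (s : X -> C) f :
  phi (feval s f) = feval (phi \o s) f.
Proof.
apply: (etrans (lrmorph_feval (phi \o feval s) f)).
by congr feval; apply: funext => v /=; rewrite feval_fvar.
Qed.

End FreeAlgebraTheory.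

(** * Linear spans *)

Section Spans.
Variables (K : nzRingType) (V : lmodType K).
Implicit Types (S : set V).

Lemma lspan_submod S : submod_set (lspan S).
Proof.
split=> [U [[U0 _] _] //|a u v Su Sv U US].
by apply: (US.1.2); [apply: Su|apply: Sv].
Qed.

Lemma lspan_scale S c u : lspan S u -> lspan S (c *: u).
Proof.
by have [S0 SD] := lspan_submod S => Su; rewrite -[c *: u]addr0; apply: SD.
Qed.

Lemma lspan_set1 (w u : V) : lspan [set w] u -> exists c, u = c *: w.
Proof.
apply: (smallest_sub (X := [set u | exists c, u = c *: w])) => [|_ ->].
  split=> [|a _ _ [c ->] [d ->]]; first by exists 0; rewrite scale0r.
  by exists (a * c + d); rewrite scalerDl scalerA.
by exists 1; rewrite scale1r.
Qed.

End Spans.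

Lemma lspan_mul (K : nzRingType) (C : algType K) (S T U : set C) u v :
    (forall u v, S u -> T v -> lspan U (u * v)) ->
  lspan S u -> lspan T v -> lspan U (u * v).
Proof.
move=> STU Su; have [U0 UD] := lspan_submod U.
apply: (smallest_sub (X := [set v | lspan U (u * v)])) => [|w Tw].
  split=> [|a v1 v2]; first by rewrite /= mulr0.
  by rewrite /= mulrDr -scalerAr => ? ?; apply: UD.
apply: (smallest_sub (X := [set u | lspan U (u * w)])) Su => [|u' Su'].
  split=> [|a v1 v2]; first by rewrite /= mul0r.
  by rewrite /= mulrDl -scalerAl => ? ?; apply: UD.
exact: STU.
Qed.

Lemma lspan_commute (K : comNzRingType) (C : algType K) (S T : set C) b u v :
    (forall u v, S u -> T v -> u * v = b *: (v * u)) ->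
  lspan S u -> lspan T v -> u * v = b *: (v * u).
Proof.
move=> ST Su; apply: (smallest_sub (X := [set v | u * v = b *: (v * u)])).
  split=> [|k w1 w2 /= e1 e2]; first by rewrite /= mulr0 mul0r scaler0.
  by rewrite mulrDr mulrDl scalerDr e2 -scalerAr -scalerAl e1 !scalerA mulrC.
move=> w Tw; apply: (smallest_sub (X := [set u | u * w = b *: (w * u)])) Su.
  split=> [|k w1 w2 /= e1 e2]; first by rewrite /= mulr0 mul0r scaler0.
  by rewrite mulrDr mulrDl scalerDr e2 -scalerAr -scalerAl e1 !scalerA mulrC.
by move=> u' Su'; apply: ST.
Qed.

(** * Graded identities as graded T-ideals *)

Lemma T_ideal_generated_T_ideal (K : comNzRingType) (G : zmodType)
  (S : set (freealg K (gvar G))) : graded_T_ideal (T_ideal_generated S).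
Proof.
split=> [|phi gphi f If J JS]; last by apply: JS.1.2 => //; apply: If.
split=> [J [[[J0 _ _] _] _] //|u v Iu Iv J JS|a u b Iu J JS].
  by case: (JS) => [[[_ JD _] _] _]; apply: JD; [apply: Iu|apply: Iv].
by case: (JS) => [[[_ _ JM] _] _]; apply: JM; apply: Iu.
Qed.

Section GradedIdentitiesTheory.
Variables (K : comNzRingType) (G : zmodType) (C : algType K).
Variable gr : G -> set C.
Hypothesis gr_submod : forall g, submod_set (gr g).
Hypothesis gr1 : gr 0 1.
Hypothesis grM : forall g h u v, gr g u -> gr h v -> gr (g + h) (u * v).

(** Multiplicativity of the grading enters here: without it, the value of a word
    need not be homogeneous, and composing a substitution with a graded
    endomorphism would not give a graded substitution. *)
Lemma feval_graded (s : gvar G -> C) g f :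
  (forall v, gr v.1 (s v)) -> free_grading g f -> gr g (feval s f).
Proof.
move=> gs; have [gr0 grD] := gr_submod g.
apply: (smallest_sub (X := [set f | gr g (feval s f)])) => [|_ [m <- <-]] /=.
  split=> [|a u v]; first by rewrite /= raddf0.
  by rewrite /= linearP; apply: grD.
rewrite feval_fmon /mon_degree; case: m => /= t.
elim: t => [|v t IHt]; rewrite ?big_nil // !big_cons.
exact: grM.
Qed.

Lemma graded_identities_T_ideal : graded_T_ideal (graded_identities gr).
Proof.
split=> [|phi gphi f If s gs].
  split=> [s _|u v Iu Iv s gs|a u b Iu s gs]; first by rewrite raddf0.
    by rewrite raddfD /= Iu // Iv // addr0.
  by rewrite !rmorphM /= Iu // mulr0 mul0r.
apply: (etrans (lrmorph_feval (feval s \o phi) f)); apply: If => v /=.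
apply: feval_graded => //; apply: gphi; apply: sub_gen_smallest.
by exists (fmu v) => //=; rewrite /mon_degree fmuE big_seq1.
Qed.

End GradedIdentitiesTheory.

(** * Commutation up to powers of q *)

Section QCommutation.
Variables (K : comNzRingType) (q : K) (C : algType K) (x y : C).
Hypothesis yx : y * x = q *: (x * y).

Lemma q_commute_exp a b :
  y ^+ b * x ^+ a = q ^+ (b * a) *: (x ^+ a * y ^+ b).
Proof.
have y1 : y * x ^+ a = q ^+ a *: (x ^+ a * y).
  elim: a => [|a IHa]; first by rewrite !expr0 mulr1 mul1r scale1r.
  by rewrite !exprS mulrA yx -scalerAl -(mulrA x y) IHa -scalerAr scalerA mulrA.
elim: b => [|b IHb]; first by rewrite mul0n !expr0 mulr1 mul1r scale1r.
rewrite mulSn exprS -mulrA IHb -scalerAr (mulrA y) y1 -scalerAl scalerA -mulrA.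
by rewrite -exprD addnC.
Qed.

Lemma q_commute_monM a b c d :
  (x ^+ a * y ^+ b) * (x ^+ c * y ^+ d) =
  q ^+ (b * c) *: (x ^+ (a + c) * y ^+ (b + d)).
Proof.
rewrite mulrA -(mulrA (x ^+ a)) q_commute_exp.
by rewrite -scalerAr -scalerAl !exprD !mulrA.
Qed.

End QCommutation.

Section QuantumPlaneTheory.
Variables (K : fieldType) (n : nat) (q : K).
Hypothesis hq : n.+2.-primitive_root q.
Local Notation G := ('Z_n.+2 * 'Z_n.+2)%type.
Local Notation qgr := (@qplane_grading K n q).

Lemma q_neq0 : q != 0.
Proof.
apply/eqP => q0; move/eqP: (prim_expr_order hq).
by rewrite q0 expr0n eq_sym oner_eq0.
Qed.

Lemma q_commute_monC (C : algType K) (x y : C) (a b c d : nat) :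
    y * x = q *: (x * y) ->
  (x ^+ a * y ^+ b) * (x ^+ c * y ^+ d) =
  (q ^+ (b * c) / q ^+ (d * a)) *: ((x ^+ c * y ^+ d) * (x ^+ a * y ^+ b)).
Proof.
move=> yx; rewrite !(q_commute_monM yx) scalerA divfK ?expf_neq0 ?q_neq0 //.
by rewrite [(c + a)%N]addnC [(d + b)%N]addnC.
Qed.

(** The definition of beta reads residues below l; since q has order l, any
    representatives will do. *)
Lemma betaE a b c d :
  beta q ((a%:R, b%:R) : G) ((c%:R, d%:R) : G) = q ^+ (b * c) / q ^+ (d * a).
Proof.
rewrite /beta /= !val_Zp_nat // expfzDr ?q_neq0 // -invr_expz -!exprnP.
rewrite -(prim_expr_mod hq (b * c)) -(prim_expr_mod hq (d * a)).
by rewrite -[in LHS](prim_expr_mod hq) -[_ ^+ (_ %% _ * _)](prim_expr_mod hq)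
  !modnMml !modnMmr [(c * b)%N]mulnC [(a * d)%N]mulnC.
Qed.

(** * The grading of the quantum plane *)

Lemma qplane_grading1 : qgr (0 : G) 1.
Proof.
by apply: sub_gen_smallest; exists 0%N, 0%N; rewrite !expr0 mulr1.
Qed.

Lemma qplane_gradingM (g h : G) u v :
  qgr g u -> qgr h v -> qgr (g + h) (u * v).
Proof.
apply: lspan_mul => _ _ [a [b [<- ->]]] [c [d [<- ->]]].
rewrite (q_commute_monM (qplane_rel q)); apply: lspan_scale.
by apply: sub_gen_smallest; exists (a + c)%N, (b + d)%N; rewrite !natrD.
Qed.

Lemma qplane_T_ideal : graded_T_ideal (graded_identities qgr).
Proof.
apply: graded_identities_T_ideal.
- by move=> g; apply: lspan_submod.
- exact: qplane_grading1.
- exact: qplane_gradingM.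
Qed.

Lemma qplane_beta (mu nu : G) u v :
  qgr mu u -> qgr nu v -> u * v = beta q mu nu *: (v * u).
Proof.
apply: lspan_commute => _ _ [a [b [<- ->]]] [c [d [<- ->]]].
by rewrite betaE; apply: q_commute_monC; apply: qplane_rel.
Qed.

Definition xy_eval (C : algType K) (x y : C) (i : 'I_2) : C :=
  if (i : nat) == 0%N then x else y.

(** The universal property of the quantum plane, read before passing to the
    quotient. *)
Lemma qplane_ideal_eval (C : algType K) (x y : C) (f : freealg K 'I_2) :
  y * x = q *: (x * y) -> qplane_ideal_set q f -> feval (xy_eval x y) f = 0.
Proof.
move=> yx; apply: (smallest_sub (X := [set f | feval _ f = 0])) => [|_ ->].
  split=> [|u v /= u0 v0|a u b /= u0]; first by rewrite /= raddf0.
    by rewrite raddfD /= u0 v0 addr0.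
  by rewrite !rmorphM /= u0 mulr0 mul0r.
apply: etrans
  (lrmorph_q_commutator (feval (xy_eval x y)) q (freex K) (freey K)) _.
by rewrite /= /freex /freey !feval_fvar /xy_eval !inordK //= yx subrr.
Qed.

(** * From the quantum plane to matrices *)

Local Notation A := (pauliA n q).
Local Notation B := (pauliB K n).

Lemma pauli_rel : A * B = q *: (B * A).
Proof.
apply/matrixP => i j; rewrite -!mulmxE mul_diag_mx mxE mul_mx_diag !mxE.
case: eqP => [->|]; last by rewrite mulr0 mul0r mulr0.
rewrite mulr1 mul1r -exprS.
have -> : (i + 1 : 'Z_n.+2) = (i.+1 %% n.+2)%N :> nat by rewrite /= addn1.
have [lt_in|ge_in] := ltnP i n.+1; first by rewrite modn_small //= subnSK.
(* The last row is where q ^+ l = 1 is needed. *)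
have -> : (i : nat) = n.+1 by apply/anti_leq; rewrite ge_in -ltnS ltn_ord.
by rewrite modnn subn0 subnn expr0 prim_expr_order.
Qed.

Lemma pauliA_unit : A \is a GRing.unit.
Proof.
rewrite -[_ \is a _]/(A \in unitmx) unitmxE det_diag unitfE.
by apply/prodf_neq0 => i _; rewrite mxE expf_neq0 ?q_neq0.
Qed.

Lemma pauliB_unit : B \is a GRing.unit.
Proof.
rewrite -[_ \is a _]/(B \in unitmx).
have: B *m B^T = 1%:M.
  apply/matrixP => i j; rewrite !mxE (bigD1 (i + 1)) //= !mxE eqxx mul1r.
  rewrite big1 ?addr0 => [|k /negPf ki]; last by rewrite !mxE ki mul0r.
  by rewrite (inj_eq (addIr _)).
by case/mulmx1_unit.
Qed.

Lemma qplane_identities_sub_pauli :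
  graded_identities qgr `<=` graded_identities (@pauli_grading K n q).
Proof.
move=> f If s gs.
have /choice[c sE] v : exists c, s v = c *: (B ^+ v.1.1 * A ^+ v.1.2).
  exact: (lspan_set1 (gs v)).
(* The same coordinates define a graded substitution in the quantum plane; it is
   written in the free algebra on x and y, where A and B can be plugged in. *)
pose t (v : gvar G) : freealg K 'I_2 :=
  c v *: (freex K ^+ v.1.1 * freey K ^+ v.1.2).
have: feval (to_quot (qplane_ideal q) \o t) f = 0.
  apply: If => v.
  have -> : (to_quot (qplane_ideal q) \o t) v =
      c v *: (qx q ^+ v.1.1 * qy q ^+ v.1.2) by apply: lrmorph_scaled_mon.
  apply: lspan_scale; apply: sub_gen_smallest.
  by exists v.1.1, v.1.2; rewrite !natr_Zp -surjective_pairing.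
rewrite -feval_comp => /eqP; rewrite to_quot_eq0 => /asboolP.
move/(qplane_ideal_eval pauli_rel); rewrite feval_comp => <-.
congr feval; apply: funext => v.
apply/esym/(etrans (lrmorph_scaled_mon (feval (xy_eval B A)) (c v)
  (freex K) (freey K) v.1.1 v.1.2)).
by rewrite /= /freex /freey !feval_fvar /xy_eval !inordK // sE.
Qed.

End QuantumPlaneTheory.

(** * Separating weights *)

(** The hypothesis says that p(w) kills the family for every monomial p, hence
    for every polynomial p; choose p vanishing at all the weights but y. *)
Lemma power_sum_separation (K : fieldType) (V : lmodType K) (T : eqType)
    (r : seq T) (w : T -> K) (F : T -> V) (y : K) :
  (forall k, \sum_(m <- r) w m ^+ k *: F m = 0) ->
  \sum_(m <- r | w m == y) F m = 0.
Proof.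
move=> pow0; have poly0 (p : {poly K}) : \sum_(m <- r) p.[w m] *: F m = 0.
  under eq_bigr do rewrite horner_coef scaler_suml.
  rewrite exchange_big big1 //= => i _.
  under eq_bigr do rewrite -scalerA.
  by rewrite -scaler_sumr pow0 scaler0.
pose p : {poly K} := \prod_(z <- map w r | z != y) ('X - z%:P).
have py : p.[y] != 0.
  rewrite horner_prod prodf_seq_neq0; apply/allP => z _; apply/implyP => zy.
  by rewrite hornerXsubC subr_eq0 eq_sym.
have := poly0 p; rewrite (bigID (fun m => w m == y)) /=.
rewrite [X in _ + X]big1_seq ?addr0 => [|m /andP[wy mr]]; last first.
  rewrite horner_prod (big_rem (w m)) ?map_f //= wy.
  by rewrite hornerXsubC subrr mul0r scale0r.
rewrite (eq_bigr (fun m => p.[y] *: F m)) => [|m /eqP -> //].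
by rewrite -scaler_sumr => /eqP; rewrite scaler_eq0 (negPf py) => /eqP.
Qed.

Lemma natr_eq_char0 (K : idomainType) (charK : [pchar K] =i pred0) m n :
  (m%:R == n%:R :> K) = (m == n).
Proof.
wlog le_mn : m n / (m <= n)%N => [th|].
  by case/orP: (leq_total m n) => /th //; rewrite eq_sym [n == _]eq_sym.
rewrite eq_sym -subr_eq0 -natrB // (pcharf0P K).1 // subn_eq0.
by rewrite eqn_leq le_mn.
Qed.

Lemma prime_sequence :
  exists p : nat -> nat, injective p /\ forall i, prime (p i).
Proof.
pose p i := iter i.+1 (fun m => sval (prime_above m)) 0%N.
exists p; split=> [i j pij|i]; last by rewrite /p iterS; case: prime_above.
have incp : {homo p : i j / (i < j)%N}.
  apply: homo_ltn => [|k]; first exact: ltn_trans.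
  by rewrite /p [iter k.+2 _ _]iterS; case: prime_above.
by case: (ltngtP i j) => // /incp; rewrite pij ltnn.
Qed.

(** Send the letters to distinct primes: the multiplicity of a letter in a word is
    then a valuation of the product. *)
Lemma unique_factorization_weight (T : countType) :
  exists p : T -> nat, forall s t : seq T,
    (\prod_(v <- s) p v = \prod_(v <- t) p v)%N -> perm_eq s t.
Proof.
have [p [p_inj p_pr]] := prime_sequence.
exists (fun v : T => p (choice.pickle v)) => s t st.
have logp (r : seq T) v :
    logn (p (choice.pickle v)) (\prod_(u <- r) p (choice.pickle u))
    = count_mem v r.
  elim: r => [|u r IHr]; first by rewrite big_nil logn1.
  have p_gt0 i : (0 < p i)%N by apply: prime_gt0.
  rewrite big_cons lognM ?p_gt0 ?prodn_gt0 // IHr logn_prime //=.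
  by rewrite (inj_eq p_inj) (inj_eq (pcan_inj choice.pickleK)) eq_sym.
by apply/allP => v _ /=; rewrite -!logp st.
Qed.

(** * Reordering words modulo an ideal *)

Section Reordering.
Variables (K : comNzRingType) (A : algType K) (I : set A).
Hypothesis I_ideal : ideal_set I.

Lemma ideal_scale a u : I u -> I (a *: u).
Proof.
have [_ _ IM] := I_ideal; move=> /(IM a%:A _ 1).
by rewrite mulr1 -scalerAl mul1r.
Qed.

Variables (X : eqType) (x : X -> A).
Hypothesis xC : forall v w, exists b, I (x v * x w - b *: (x w * x v)).
Local Notation word s := (\prod_(v <- s) x v).

Lemma word_commute v s :
  exists c, I (x v * word s - c *: (word s * x v)).
Proof.
have [I0 ID IM] := I_ideal.
elim: s => [|w s [c IHs]].
  by exists 1; rewrite big_nil mulr1 mul1r scale1r subrr.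
have [b vw] := xC v w; exists (b * c).
rewrite big_cons; set S := word s in IHs *.
have -> : x v * (x w * S) - (b * c) *: (x w * S * x v) =
    1 * (x v * x w - b *: (x w * x v)) * S
    + b *: (x w * (x v * S - c *: (S * x v)) * 1).
  rewrite mul1r mulr1 mulrBl mulrBr scalerBr -!scalerAl -scalerAr scalerA.
  by rewrite !mulrA addrA subrK.
by apply: ID; [apply: IM|apply/ideal_scale/IM].
Qed.

(** Letters are brought to the front one at a time.  Leaving c implicit costs
    nothing: over a field, in an algebra where the elements of I vanish, c can be
    read off from the values of the two words once the value of t is nonzero. *)
Lemma word_perm s t : perm_eq s t -> exists c, I (word s - c *: word t).
Proof.
have [I0 ID IM] := I_ideal.
elim: s t => [|v s IHs] t.
  by rewrite perm_sym => /perm_nilP ->; exists 1; rewrite scale1r subrr.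
move=> st; have vt: v \in t by rewrite -(perm_mem st) mem_head.
case/splitPr: vt st => t1 t2 st.
have [c sI] : exists c, I (word s - c *: word (t1 ++ t2)).
  apply: IHs; rewrite -(perm_cons v) (perm_trans st) //.
  by rewrite -cat1s perm_catCA.
have [d vI] := word_commute v t1; exists (c * d); move: sI vI.
rewrite !big_cat !big_cons /=.
set S := word s; set T1 := word t1; set T2 := word t2 => sI vI.
have -> : x v * S - (c * d) *: (T1 * (x v * T2)) =
    x v * (S - c *: (T1 * T2)) * 1
    + c *: (1 * (x v * T1 - d *: (T1 * x v)) * T2).
  rewrite mul1r mulr1 mulrBl mulrBr scalerBr -!scalerAl -scalerAr scalerA.
  by rewrite !mulrA addrA subrK.
by apply: ID; [apply: IM|apply/ideal_scale/IM].
Qed.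

End Reordering.

(** * Identities of the matrix algebra *)

Section NormalForm.
Variables (K : fieldType) (n : nat) (q : K).
Hypotheses (charK : [pchar K] =i pred0) (hq : n.+2.-primitive_root q).
Local Notation G := ('Z_n.+2 * 'Z_n.+2)%type.
Local Notation F := (freealg K (gvar G)).
Local Notation A := (pauliA n q).
Local Notation B := (pauliB K n).
Variable I : set F.
Hypotheses (I_ideal : ideal_set I) (commI : @comm_identities K n q `<=` I).
Hypothesis I_pauli : I `<=` graded_identities (@pauli_grading K n q).

Lemma fvar_commute (v w : gvar G) :
  exists b, I (fvar K v * fvar K w - b *: (fvar K w * fvar K v)).
Proof.
have [-> | vw] := eqVneq v w.
  by exists 1; rewrite scale1r subrr; case: I_ideal.
case: v w vw => [mu i] [nu j] vw; exists (beta q mu nu); apply: commI.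
by exists mu, nu, i, j; split=> //; apply/eqP.
Qed.

Definition pauli_elt (v : gvar G) : 'M[K]_n.+2 := B ^+ v.1.1 * A ^+ v.1.2.

Lemma pauli_grading_scale v c : pauli_grading q v.1 (c *: pauli_elt v).
Proof.
by apply: lspan_scale; apply: sub_gen_smallest.
Qed.

Lemma pauli_word_unit (s : seq (gvar G)) :
  \prod_(v <- s) pauli_elt v \is a GRing.unit.
Proof.
elim: s => [|v s IHs]; rewrite ?big_nil ?unitr1 // big_cons.
by rewrite unitrMr ?unitrMr ?unitrX ?pauliA_unit ?pauliB_unit.
Qed.

(** Each variable v is replaced by p(v)^k times a homogeneous matrix. *)
Lemma pauli_identity_power_sum (f : F) (p : gvar G -> nat) (k : nat) :
  graded_identities (@pauli_grading K n q) f ->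
  \sum_(m <- msupp f) (\prod_(v <- (m : seq (gvar G))) p v)%:R ^+ k *:
    (mcoeff m f *: \prod_(v <- (m : seq (gvar G))) pauli_elt v)
  = 0 :> 'M[K]_n.+2.
Proof.
move=> If; rewrite -[RHS](If (fun v => (p v)%:R ^+ k *: pauli_elt v)).
  rewrite [in RHS](freealgE f) raddf_sum; apply: eq_bigr => m _ /=.
  rewrite linearZ [RHS]linearZ /= feval_fmon; congr (_ *: _).
  case: m => s; elim: s => [|v s IHs]; first by rewrite !big_nil expr1n scale1r.
  by rewrite !big_cons -IHs natrM exprMn -scalerAl -scalerAr scalerA.
by move=> v; apply: pauli_grading_scale.
Qed.

(** Any total order on the variables gives canonical rearrangements; the one
    used here comes from an enumeration of the variables. *)
Definition sort_mon (m : {fmonom gvar G}) : {fmonom gvar G} :=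
  FMonom (sort (relpre (@choice.pickle ('Z_n.+2 * 'Z_n.+2 * nat)%type) leq) m).

Lemma sort_mon_perm (m : {fmonom gvar G}) :
  perm_eq (m : seq (gvar G)) (sort_mon m).
Proof. by rewrite perm_sym; apply/permPl/perm_sort. Qed.

Lemma sort_monP (m m' : {fmonom gvar G}) :
  reflect (sort_mon m = sort_mon m') (perm_eq (m : seq (gvar G)) m').
Proof.
apply: (iffP idP) => [mm'|mm'].
  congr FMonom; apply/perm_sortP: mm'.
  - by move=> u v; apply: leq_total.
  - by move=> u v w; apply: leq_trans.
  - by move=> u v /anti_leq; apply: (pcan_inj choice.pickleK).
by rewrite (perm_trans (sort_mon_perm m)) // mm' perm_sym sort_mon_perm.
Qed.

(** An identity f is congruent to a combination g of sorted words.  The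
    coefficient of g at a sorted word k collects the words of f that sort to k;
    separation by weights shows that its product with the value P k is 0, and
    P k is invertible. *)
Lemma pauli_identities_sub : graded_identities (@pauli_grading K n q) `<=` I.
Proof.
have [I0 ID IM] := I_ideal; move=> f If.
have /choice[c cP] (m : {fmonom gvar G}) :
    exists c, I (fmon K m - c *: fmon K (sort_mon m)).
  have [c cI] := word_perm I_ideal fvar_commute (sort_mon_perm m).
  by exists c; rewrite -[m in fmon K m]fmK !fmon_prod.
pose g : F := \sum_(m <- msupp f) (mcoeff m f * c m) *: fmon K (sort_mon m).
have fgI : I (f - g).
  rewrite [f in f - g]freealgE -sumrB; apply: (big_ind I) => // m _.
  by rewrite -scalerA -scalerBr; apply: ideal_scale.
suff g0 : g = 0 by rewrite g0 subr0 in fgI.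
pose P (m : {fmonom gvar G}) : 'M[K]_n.+2 :=
  \prod_(v <- (m : seq (gvar G))) pauli_elt v.
(* The reordering scalars need not be computed: the identities in I force
   them to relate the values of the words. *)
have PE m : P m = c m *: P (sort_mon m).
  have /(_ pauli_elt) := I_pauli (cP m).
  rewrite raddfB /= linearZ /= !feval_fmon => /(_ _)/subr0_eq; apply=> v.
  by rewrite -[pauli_elt v]scale1r; apply: pauli_grading_scale.
apply: freealg_eq0 => k; rewrite mcoeff_sum_fmon.
(* If k is not sorted, no word sorts to k. *)
have [kk|kk] := eqVneq (sort_mon k) k; last first.
  apply: big_pred0 => m; apply: contraNF kk => /eqP <-.
  by apply/eqP/sort_monP; rewrite perm_sym; apply: sort_mon_perm.
have [p p_perm] := unique_factorization_weight ('Z_n.+2 * 'Z_n.+2 * nat)%type.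
have Pk0 : P k != 0.
  by apply: contraTneq (pauli_word_unit k) => Pk; rewrite -/(P k) Pk unitr0.
suff: (\sum_(m <- msupp f | sort_mon m == k) mcoeff m f * c m) *: P k = 0.
  by move/eqP; rewrite scaler_eq0 (negPf Pk0) orbF => /eqP.
pose w (m : {fmonom gvar G}) : K := (\prod_(v <- (m : seq (gvar G))) p v)%:R.
have wE m : (sort_mon m == k) = (w m == w k).
  rewrite /w natr_eq_char0 //; apply/eqP/eqP => [mk|/p_perm mk].
    by apply: perm_big; apply/sort_monP; rewrite mk.
  by rewrite -kk; apply/sort_monP.
rewrite scaler_suml (eq_bigl _ _ wE).
rewrite -[RHS](power_sum_separation (w k) (pauli_identity_power_sum p ^~ If)).
by apply: eq_bigr => m; rewrite -wE -scalerA -/(P m) (PE m) => /eqP ->.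
Qed.

End NormalForm.

Lemma T_ideal_sub_qplane (K : fieldType) n (q : K) :
    n.+2.-primitive_root q ->
  T_ideal_generated (@comm_identities K n q) `<=`
    graded_identities (@qplane_grading K n q).
Proof.
move=> hq; apply: smallest_sub; first exact: qplane_T_ideal.
move=> _ [mu [nu [i [j [_ ->]]]]] s gs; apply/eqP.
rewrite (lrmorph_q_commutator (feval s)) subr_eq0 /= !feval_fvar; apply/eqP.
exact: (qplane_beta hq (gs (mu, i)) (gs (nu, j))).
Qed.

Theorem corollary41 (K : closedFieldType) (hK : [pchar K] =i pred0)
    (n : nat) (q : K) (q0 : q != 0) (q1 : q != 1)
    (hq : n.+2.-primitive_root q) :
  graded_identities (@qplane_grading K n q)
    = graded_identities (@pauli_grading K n q) /\
  graded_identities (@qplane_grading K n q)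
    = T_ideal_generated (@comm_identities K n q).
Proof.
have T_qplane := T_ideal_sub_qplane hq.
have qplane_pauli := qplane_identities_sub_pauli hq.
have pauli_T : graded_identities (@pauli_grading K n q) `<=`
    T_ideal_generated (@comm_identities K n q).
  apply: pauli_identities_sub => //.
  - by case: (T_ideal_generated_T_ideal (@comm_identities K n q)).
  - exact: sub_gen_smallest.
  - exact: subset_trans qplane_pauli.
split; apply/seteqP; split=> //.
- exact: subset_trans T_qplane.
- exact: subset_trans pauli_T.
Qed.
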